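(* (1) For $p$ an odd prime (and $e=1$), $(\operatorname{Aut}(\mathbb{Z}/p\mathbb{Z},\cdot),\circ)\simeq(U_{p-1},\cdot)$. In particular, $|\operatorname{Aut}(\mathbb{Z}/p\mathbb{Z},\cdot)|=\varphi(p-1)$. (2) For $p$ an odd prime and $e\ge2$, $$(\operatorname{Aut}(\mathbb{Z}/p^e\mathbb{Z},\cdot),\circ)\simeq(\mathbb{Z}/p^{e-2}(p-1)\mathbb{Z}\rtimes U_{p^{e-1}(p-1)},\ast),$$ where the underlying set of the right-hand side is the Cartesian product and, for $u,u',v,v'\in\mathbb{Z}$ with $\gcd(v,p(p-1))=\gcd(v',p(p-1))=1$, $$([u]_{p^{e-2}(p-1)},[v]_{p^{e-1}(p-1)})\ast([u']_{p^{e-2}(p-1)},[v']_{p^{e-1}(p-1)})=([u+u'v]_{p^{e-2}(p-1)},[vv']_{p^{e-1}(p-1)}).$$ This isomorphism can be explicitly constructed by choosing a generator $a$ of $U_{p^{e-1}}$ and mapping each automorphism $\psi_{r,\chi_{p^e,t}}$ to $([s]_{p^{e-2}(p-1)},[t]_{p^{e-1}(p-1)})$, where $s$ is an integer satisfying $[r]_{p^{e-1}}=a^s$. In particular, $|\operatorname{Aut}(\mathbb{Z}/p^e\mathbb{Z},\cdot)|=(p^{e-2}(p-1))^2\varphi(p-1)$. (3) $(\operatorname{Aut}(\mathbb{Z}/8\mathbb{Z},\cdot),\circ)\simeq(\mathbb{Z}/2\mathbb{Z}\times\mathbb{Z}/2\mathbb{Z},+)$. (4) When $p=2$ and $e\ge4$,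 $$(\operatorname{Aut}(\mathbb{Z}/2^e\mathbb{Z},\cdot),\circ)\simeq\big(\mathbb{Z}/2\mathbb{Z}\times\mathbb{Z}/2\mathbb{Z}\times(\mathbb{Z}/2^{e-3}\mathbb{Z}\rtimes U_{2^{e-2}}),\#\big),$$ where the underlying set of the right-hand side is the Cartesian product and, for $u,s,v,t,u',s',v',t'\in\mathbb{Z}$ with $\gcd(t,2)=\gcd(t',2)=1$, $$([u]_2,[s]_2,([v]_{2^{e-3}},[t]_{2^{e-2}}))\,\#\,([u']_2,[s']_2,([v']_{2^{e-3}},[t']_{2^{e-2}}))=([u+u']_2,[s+s']_2,([v+tv']_{2^{e-3}},[tt']_{2^{e-2}})).$$ This isomorphism can be explicitly constructed by mapping each automorphism $\psi_{r,\chi_{2^e,(s,0,t)}}$ (with $(s,0,t)\in T_{2^e}$) to $([u]_2,[s/2^{e-3}]_2,([v]_{2^{e-3}},[t]_{2^{e-2}}))$, where $u,v$ are integers satisfying $[r]_{2^{e-1}}=[-1]_{2^{e-1}}^u[5]_{2^{e-1}}^v$. In particular, for $e=4$, $(\operatorname{Aut}(\mathbb{Z}/16\mathbb{Z},\cdot),\circ)\simeq(\mathbb{Z}/2\mathbb{Z}\times\mathbb{Z}/2\mathbb{Z}\times\mathbb{Z}/2\mathbb{Z}\times\mathbb{Z}/2\mathbb{Z},+)$. In general (for $e\ge 4$), $|\operatorname{Aut}(\mathbb{Z}/2^e\mathbb{Z},\cdot)|=2^{2(e-2)}$.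
   Context: $[a]_n$ is the class of the integer $a$ modulo $n$, and $[a]$ means $[a]_{p^e}$. $U_n$ is the multiplicative group of invertible classes modulo $n$. $\varphi$ is Euler's totient function. $\operatorname{Aut}(\mathbb{Z}/p^e\mathbb{Z},\cdot)$ is the group of automorphisms of the multiplicative monoid $(\mathbb{Z}/p^e\mathbb{Z},\cdot,[1])$. Convention: $x^0=[1]$ for all $x\in\mathbb{Z}/p^e\mathbb{Z}$, including $[0]$. $\mathcal{A}_{p^e}$ is the subgroup of $\operatorname{Aut}(U_{p^e},\cdot)$ consisting of those $\phi$ such that for all integers $r,r',s,s',f$ with $\gcd(r,p)=\gcd(r',p)=1$, $\phi([r])=[s]$, $\phi([r'])=[s']$ and $0\le f\le e$, one has $[r]_{p^f}=[r']_{p^f}$ if and only if $[s]_{p^f}=[s']_{p^f}$. For $r\in\mathbb{Z}$ with $\gcd(r,p)=1$ and $\phi\in\mathcal{A}_{p^e}$, $\psi_{r,\phi}$ is the automorphism of $(\mathbb{Z}/p^e\mathbb{Z},\cdot)$ given by $\psi_{r,\phi}([p]^ub)=[pr]^u\phi(b)$ for $u\in\{0,\dots,e\}$, $b\in U_{p^e}$; every automorphism of $(\mathbb{Z}/p^e\mathbb{Z},\cdot)$ is of this form. For $p$ odd, $\mathcal{A}_{p^e}=\operatorname{Aut}(U_{p^e},\cdot)=\{\chi_{p^e,t}\}$, where $\chi_{p^e,t}(a)=a^t$ for $t\in\{0,\dots,p^{e-1}(p-1)-1\}$ with $\gcd(t,p^{e-1}(p-1))=1$. For $p=2$ and $e\ge4$,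 $T_{2^e}=\{(t_1,t_2,t_3)\mid t_1\in\{0,2^{e-3}\},\ t_2\in\{0,1\},\ t_3\in\{0,\dots,2^{e-2}-1\},\ \gcd(t_3,2)=1\}$, and for $t=(t_1,t_2,t_3)\in T_{2^e}$, $\chi_{2^e,t}$ is the automorphism of $U_{2^e}$ sending $[-1]$ to $[-1][5]^{t_1}$ and $[5]$ to $[-1]^{t_2}[5]^{t_3}$; moreover $\mathcal{A}_{2^e}=\{\chi_{2^e,(t_1,0,t_3)}\mid(t_1,0,t_3)\in T_{2^e}\}$. *)

(* Defs.v *)
From HB Require Import structures.
From mathcomp Require Import all_boot all_order all_algebra all_fingroup.
From mathcomp Require Import all_solvable.

Set Implicit Arguments.
Unset Strict Implicit.
Unset Printing Implicit Defensive.

Import GRing.Theory.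

Local Open Scope ring_scope.

(* Automorphisms of the multiplicative monoid (R, *, 1), as a group for       *)
(* composition: (f * g)%g is f \o g (see mulAutM), which is the opposite of   *)
(* the product of f and g in {perm R}.                                        *)

Section MulAut.

Variable R : finNzRingType.

Definition is_mulAut (f : {perm R}) : bool :=
  (f 1 == 1) && [forall x, forall y, f (x * y) == f x * f y].

Lemma is_mulAutP (f : {perm R}) :
  reflect (GRing.monoid_morphism f) (is_mulAut f).
Proof.
apply: (iffP andP) => [[/eqP f1 /forallP fM] | [f1 fM]].
  by split=> // x y; apply/eqP; move/forallP: (fM x).
by rewrite f1 eqxx; split=> //; apply/forallP => x; apply/forallP => y; rewrite fM.
Qed.

Record mulAut := MulAut {mulAut_perm :> {perm R}; _ : is_mulAut mulAut_perm}.

HB.instance Definition _ := [isSub for mulAut_perm].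
HB.instance Definition _ := [Finite of mulAut by <:].

Implicit Types f g h : mulAut.

Lemma mulAut_monoid_morphism f : GRing.monoid_morphism f.
Proof. by apply/is_mulAutP; case: f. Qed.

Fact mulAut_one_subproof : is_mulAut 1%g.
Proof. by apply/is_mulAutP; split=> [|x y]; rewrite !perm1. Qed.

Fact mulAut_comp_subproof f g : is_mulAut (mulAut_perm g * mulAut_perm f)%g.
Proof.
have [[f1 fM] [g1 gM]] := (mulAut_monoid_morphism f, mulAut_monoid_morphism g).
by apply/is_mulAutP; split=> [|x y]; rewrite !permM ?g1 // gM fM.
Qed.

Fact mulAut_inv_subproof f : is_mulAut (mulAut_perm f)^-1%g.
Proof.
have [f1 fM] := mulAut_monoid_morphism f.
apply/is_mulAutP; split=> [|x y]; apply: (@perm_inj _ f).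
  by rewrite permKV f1.
by rewrite fM !permKV.
Qed.

Definition mulAut_one : mulAut := MulAut mulAut_one_subproof.
Definition mulAut_comp f g : mulAut := MulAut (mulAut_comp_subproof f g).
Definition mulAut_inv f : mulAut := MulAut (mulAut_inv_subproof f).

Fact mulAut_compA : associative mulAut_comp.
Proof. by move=> f g h; apply: val_inj; rewrite /= mulgA. Qed.

Fact mulAut_comp1 : left_id mulAut_one mulAut_comp.
Proof. by move=> f; apply: val_inj; rewrite /= mulg1. Qed.

Fact mulAut_compV : left_inverse mulAut_one mulAut_inv mulAut_comp.
Proof. by move=> f; apply: val_inj; rewrite /= mulgV. Qed.

HB.instance Definition _ :=
  Finite_isGroup.Build mulAut mulAut_compA mulAut_comp1 mulAut_compV.

Lemma mulAutM f g x : (f * g)%g x = f (g x).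
Proof. exact: permM. Qed.

End MulAut.

(* The class [k]_n in U_n, for k coprime to n; it is 1 for other k. *)
Definition unitZ (n : nat) (k : int) : {unit 'Z_n} :=
  insubd (1%g : {unit 'Z_n}) (k%:~R : 'Z_n).

(* f is psi_(r, phi), i.e., f ([p]^u b) = [p r]^u phi(b). *)
Definition is_psi (p e : nat) (r : int) (phi : {unit 'Z_(p ^ e)} -> {unit 'Z_(p ^ e)})
    (f : mulAut 'Z_(p ^ e)) : Prop :=
  forall (u : nat) (b : {unit 'Z_(p ^ e)}), (u <= e)%N ->
    f (p%:R ^+ u * val b) = (p%:Z * r)%:~R ^+ u * val (phi b).

Definition chi_odd (p e t : nat) (a : {unit 'Z_(p ^ e)}) : {unit 'Z_(p ^ e)} :=
  (a ^+ t)%g.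

Arguments is_psi p e r phi f : clear implicits.
Arguments chi_odd p e t a : clear implicits.

Definition T2 (e : nat) (t : nat * nat * nat) : bool :=
  let: (t1, t2, t3) := t in
  [&& t1 \in [:: 0; 2 ^ (e - 3)], t2 \in [:: 0; 1],
      t3 < 2 ^ (e - 2) & coprime t3 2]%N.

Definition is_chi2 (e : nat) (t : nat * nat * nat)
    (chi : {perm {unit 'Z_(2 ^ e)}}) : Prop :=
  let: (t1, t2, t3) := t in
  [/\ chi \in Aut [set: {unit 'Z_(2 ^ e)}],
      chi (unitZ (2 ^ e) (-1)) =
        (unitZ (2 ^ e) (-1) * unitZ (2 ^ e) 5 ^+ t1)%g
    & chi (unitZ (2 ^ e) 5) =
        (unitZ (2 ^ e) (-1) ^+ t2 * unitZ (2 ^ e) 5 ^+ t3)%g].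

Arguments is_chi2 e t chi : clear implicits.

(* The semidirect product of Z/m and U_n, where U_n acts on Z/m by            *)
(* multiplication: (u, v) * (u', v') = (u + u' v, v v') (see sdZU_mulE).       *)
(* Reducing v modulo m requires m %| n; as 'Z_m is the ring of integers       *)
(* modulo (Zp_trunc m).+2 (which is m for 1 < m), the condition is stated on  *)
(* these moduli.                                                              *)

Definition Zdvd (m n : nat) : bool := ((Zp_trunc m).+2 %| (Zp_trunc n).+2)%N.

Definition sdZU (m n : nat) (mn : Zdvd m n) : Type := ('Z_m * {unit 'Z_n})%type.

Section SdZU.

Variables (m n : nat) (mn : Zdvd m n).

Definition redZ (x : 'Z_n) : 'Z_m := (x : nat)%:R.

Fact redZ_nat (k : nat) : redZ k%:R = k%:R.
Proof. by rewrite /redZ !Zp_nat; apply: val_inj; rewrite /= modn_dvdm. Qed.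

Fact redZM x y : redZ (x * y) = redZ x * redZ y.
Proof. by rewrite -[x]natr_Zp -[y]natr_Zp -natrM !redZ_nat natrM. Qed.

Fact redZD x y : redZ (x + y) = redZ x + redZ y.
Proof. by rewrite -[x]natr_Zp -[y]natr_Zp -natrD !redZ_nat natrD. Qed.

Fact redZ_int (k : int) : redZ k%:~R = k%:~R.
Proof.
case: k => k; first exact: redZ_nat.
rewrite NegzE !mulrNz; apply: (@addIr _ k.+1%:R).
by rewrite addNr -[X in _ + X]redZ_nat -redZD addNr (redZ_nat 0).
Qed.

Local Notation S := (sdZU mn).

HB.instance Definition _ := Finite.on S.

Definition sdZU_one : S := (0, 1%g).
Definition sdZU_mul (x y : S) : S :=
  (x.1 + y.1 * redZ (val x.2), (x.2 * y.2)%g).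
Definition sdZU_inv (x : S) : S :=
  (- (x.1 * redZ (val (x.2^-1)%g)), (x.2^-1)%g).

Fact sdZU_mulA : associative sdZU_mul.
Proof.
move=> x y z; congr (_, _); last exact: mulgA.
by rewrite /= redZM mulrDl addrA -!mulrA [redZ _ * redZ _]mulrC.
Qed.

Fact sdZU_mul1 : left_id sdZU_one sdZU_mul.
Proof.
move=> [x v]; rewrite /sdZU_mul /= mul1g add0r.
by rewrite (redZ_nat 1) mulr1.
Qed.

Fact sdZU_mulV : left_inverse sdZU_one sdZU_inv sdZU_mul.
Proof. by move=> x; rewrite /sdZU_mul /= mulVg addNr. Qed.

HB.instance Definition _ :=
  Finite_isGroup.Build S sdZU_mulA sdZU_mul1 sdZU_mulV.

Lemma val_unitZ (k : int) : (1 < n)%N -> coprimez k n -> val (unitZ n k) = k%:~R.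
Proof.
move=> n1 kn; rewrite /unitZ val_insubd.
suff -> : (k%:~R : 'Z_n) \is a GRing.unit by [].
case: k kn => k kn; rewrite ?NegzE ?mulrNz ?unitrN unitZpE // coprime_sym;
  exact: kn.
Qed.

Lemma sdZU_mulE (u v u' v' : int) :
    (1 < n)%N -> coprimez v n -> coprimez v' n ->
  (((u%:~R, unitZ n v) : S) * ((u'%:~R, unitZ n v') : S))%g
    = ((u + u' * v)%:~R, unitZ n (v * v')).
Proof.
move=> n1 vn v'n; congr (_, _).
  by rewrite /= val_unitZ // redZ_int -intrM -intrD.
apply: val_inj; rewrite FinRing.val_unitM !val_unitZ ?intrM //.
by rewrite coprimezMl vn.
Qed.

End SdZU.

Lemma Zdvd_odd (p e : nat) : Zdvd (p ^ (e - 2) * p.-1) (p ^ (e - 1) * p.-1).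
Proof.
rewrite /Zdvd.
case: p => [|[|p]]; first by rewrite !muln0.
  by rewrite !muln0.
case: e => [|[|e]] //.
have -> : (e.+2 - 1 = (e.+2 - 2).+1)%N by rewrite !subSS !subn0.
set k := (e.+2 - 2)%N.
have h0 : (0 < p.+2 ^ k)%N by rewrite expn_gt0.
have [pk|pk] := boolP (1 < p.+2 ^ k * p.+1)%N.
  have pk1 : (1 < p.+2 ^ k.+1 * p.+1)%N.
    by rewrite expnS -mulnA (leq_trans pk) // leq_pmull.
  by rewrite !Zp_cast // expnS -mulnA dvdn_mull.
have : (p.+2 ^ k * p.+1 = 1)%N.
  by apply/eqP; rewrite eqn_leq leqNgt pk muln_gt0 h0.
move=> E; rewrite expnS -mulnA E muln1.
by move/eqP: E; rewrite muln_eq1 => /andP[_ /eqP[->]].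
Qed.

Lemma Zdvd_two (e : nat) : Zdvd (2 ^ (e - 3)) (2 ^ (e - 2)).
Proof.
by have := Zdvd_odd 2 (e - 1); rewrite !muln1 -!subnDA.
Qed.

(* Main.v *)
Require Import Defs.
From mathcomp Require Import all_boot all_order all_algebra all_fingroup.
From mathcomp Require Import all_solvable.
From mathcomp Require Import ring.

Set Implicit Arguments.
Unset Strict Implicit.
Unset Printing Implicit Defensive.

Import GRing.Theory.

Local Open Scope ring_scope.

(* Every element of Z/p^e is [p]^u b with b a unit, so an automorphism f of   *)
(* the multiplicative monoid is determined by f [p] = [p r], for a unit r     *)
(* that matters only modulo p^(e-1), and by its restriction phi to the units. *)
(* Conversely (r, phi) comes from an automorphism as soon as phi respects the *)
(* equalities [p]^u b = [p]^u c, and (r, phi) (r', phi') is                   *)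
(* (r phi(r'), phi phi').  For p odd the units are cyclic, so that phi is a   *)
(* power map, and power maps respect these equalities.  For p = 2 the units   *)
(* are <-1> x <5>; as f preserves equality of units modulo 4, phi 5 is a      *)
(* power of 5 and phi (-1) is -1 or -z, where z = 5^(2^(e-3)) satisfies       *)
(* 2 z = 2.                                                                   *)

(** By the composition rule above, the automorphism group is a semidirect product of the units r
    modulo p^(e-1) by the group of admissible phi; each part of the theorem writes this product in
    coordinates. [psi_exists] builds an automorphism from a pair (r, phi), [mulAut_p] and
    [mulAut_res_compat] recover such a pair, and [mulp_eq] accounts for the modulus p^(e-1).

    For p odd, put r = a^s with a a generator modulo p^(e-1). The power map b -> b^t multiplies s by
    t, whence the semidirect product of Z/p^(e-2)(p-1) by the units modulo p^(e-1)(p-1)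
    ([mulAut_odd_misom]). If e = 1, then [p] = 0 and only t remains ([mulAut_Zp_isog]).

    For p = 2, put r = (-1)^u 5^v, and let phi send -1 to -z^s and 5 to 5^t ([psi2_total]). In a
    composite, the power of z coming from phi(-1) is absorbed by the factor 2, and z^t = z because t
    is odd; so u and s simply add, and only v is twisted by t ([psi2M]). The cases e = 3, e = 4 and
    e >= 4 are the same four parameters, read modulo the appropriate powers of 2 ([psi2_misom]).

    Each isomorphism comes from a relation between automorphisms and parameters that is bijective
    and multiplicative ([misom_of_rel]). The relation is kept next to the map, so that one map
    serves both the isomorphism and its explicit description. *)

Lemma misom_of_rel (gT rT : finGroupType) (P : gT -> rT -> Prop) :
    (forall f, exists x, P f x) -> (forall x, exists f, P f x) ->
    (forall f x y, P f x -> P f y -> x = y) ->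
    (forall f g x, P f x -> P g x -> f = g) ->
    (forall f g x y, P f x -> P g y -> P (f * g)%g (x * y)%g) ->
  exists2 F : gT -> rT,
    misom [set: gT] [set: rT] F & forall f x, P f x -> F f = x.
Proof.
move=> /fin_all_exists[F PF] Psurj Pfun Pinj PM; exists F => [|f x]; last first.
  exact: Pfun.
have FM : {morph F : f g / (f * g)%g}.
  by move=> f g; apply: Pfun (PM _ _ _ _ _ _).
pose Fm := @Morphism _ _ [set: gT] F (in2W FM).
apply/misomP; exists (introT morphicP (in2W FM)); apply/isomP; split.
  by apply/injmP=> f g _ _ eqF; apply: (Pinj f g (F f)); rewrite // [F f]eqF.
apply/setP=> x; rewrite inE morphimEdom; have [f Pfx] := Psurj x.
by apply/imsetP; exists f => //; apply: Pfun Pfx _.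
Qed.

Lemma morphM1 (gT rT : finGroupType) (f : gT -> rT) :
  {morph f : b c / (b * c)%g} -> f 1%g = 1%g.
Proof. by move=> fM; apply: (mulgI (f 1%g)); rewrite -fM !mulg1. Qed.

Lemma morphMX (gT rT : finGroupType) (f : gT -> rT) k :
  {morph f : b c / (b * c)%g} -> {morph f : b / (b ^+ k)%g}.
Proof.
move=> fM b; elim: k => [|k IH]; first exact: morphM1.
by rewrite !expgS fM IH.
Qed.

Lemma expr_Zp_nat (R : nzRingType) (x : R) (m k : nat) :
  (1 < m)%N -> x ^+ m = 1 -> x ^+ (k%:R : 'Z_m) = x ^+ k.
Proof. by move=> m_gt1 xm; rewrite val_Zp_nat // expr_mod. Qed.

Lemma exprz_Zp (R : unitRingType) (x : R) (m : nat) (k : int) :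
  (1 < m)%N -> x ^+ m = 1 -> x ^ k = x ^+ (k%:~R : 'Z_m).
Proof.
move=> m_gt1 xm; have Ux : x \is a GRing.unit.
  by rewrite -(unitrX_pos _ (ltnW m_gt1)) xm unitr1.
case: k => k; first by rewrite expr_Zp_nat.
rewrite NegzE mulrNz -exprnN; set y : 'Z_m := - _.
(* The two exponents are opposite in Z/m, so that after this multiplication both sides are 1. *)
apply: (@mulIr _ (x ^+ k.+1)); first exact: unitrX.
rewrite mulVr ?unitrX // -exprD -(expr_Zp_nat _ m_gt1 xm) natrD natr_Zp.
by rewrite addNr expr0.
Qed.

Lemma expg_coprime_inj (gT : finGroupType) (t : nat) :
  coprime #|[set: gT]| t -> injective (fun b : gT => b ^+ t)%g.
Proof.
move=> co_t; apply: (can_inj (g := fun b => b ^+ expg_invn [set: gT] t)%g) => b.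
by rewrite expgK ?inE.
Qed.

(** * Automorphisms of the monoid Z/p^e, for any prime p *)

Section PrimePower.

Variables (p e : nat).
Hypotheses (p_pr : prime p) (e_gt0 : (0 < e)%N).

Local Notation R := 'Z_(p ^ e).
Local Notation U := {unit R}.
Local Notation P := (p%:R : R).

Lemma pexp_gt1 : (1 < p ^ e)%N.
Proof. by rewrite -(exp1n e) ltn_exp2r // prime_gt1. Qed.
Let q_gt1 := pexp_gt1.

Lemma natr_unit_pexp (k : nat) : ((k%:R : R) \is a GRing.unit) = ~~ (p %| k)%N.
Proof. by rewrite unitZpE // coprime_pexpl // prime_coprime. Qed.

Lemma unit_pexpE (x : R) : (x \is a GRing.unit) = ~~ (p %| x)%N.
Proof. by rewrite -[in LHS](natr_Zp x) natr_unit_pexp. Qed.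

Lemma card_unit_pexp : #|[set: U]| = (p ^ e.-1 * p.-1)%N.
Proof.
rewrite -[[set: _]]/(units_Zp _) card_units_Zp ?expn_gt0 ?prime_gt0 //.
by rewrite totient_pfactor // mulnC.
Qed.

Lemma expr_p_eq0 u : (P ^+ u == 0) = (e <= u)%N.
Proof.
rewrite -natrX -(inj_eq val_inj) [X in X == _]val_Zp_nat //.
by rewrite -[(_ %% _ == _)%N]/(_ %| _)%N dvdn_Pexp2l // prime_gt1.
Qed.

(** The exponent is the p-adic valuation of the representative of x, except for 0, which is written
    [p]^e 1. *)
Lemma pexp_unitP (x : R) :
  exists u (b : U), (u <= e)%N /\ x = P ^+ u * val b.
Proof.
have [->|x_neq0] := eqVneq x 0.
  exists e, 1%g; split=> //; apply/esym/eqP.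
  by rewrite mulr1 expr_p_eq0.
have x_gt0 : (0 < x)%N by rewrite lt0n; exact: x_neq0.
have [k cop xE] := pfactor_coprime p_pr x_gt0.
have Uk : (k%:R : R) \is a GRing.unit.
  by rewrite natr_unit_pexp -prime_coprime.
have xE' : x = P ^+ logn p x * k%:R.
  by rewrite -natrX -natrM mulnC -xE natr_Zp.
exists (logn p x), (Sub (k%:R : R) Uk); split=> //.
rewrite leqNgt; apply: contra x_neq0 => lt_e; rewrite xE'.
by have /eqP-> : P ^+ logn p x == 0; rewrite ?mul0r // expr_p_eq0 ltnW.
Qed.

Lemma pexp_unit_inj u v (b c : U) : (u <= e)%N -> (v <= e)%N ->
  P ^+ u * val b = P ^+ v * val c -> u = v.
Proof.
wlog lt_uv : u v b c / (u < v)%N => [IH le_u le_v eq_bc|le_u le_v eq_bc].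
  have [lt_uv|lt_vu|//] := ltngtP u v; first exact: IH eq_bc.
  by apply/esym/(IH v u c b) => //; apply: esym.
(* Multiplying by p^(e-v) kills the right-hand side, while e - v + u < e keeps the left-hand side
   nonzero. *)
have: P ^+ (e - v + u) * val b = 0.
  rewrite exprD -mulrA eq_bc mulrA -exprD subnK //; apply/eqP.
  by have /eqP-> : P ^+ e == 0; rewrite ?mul0r // expr_p_eq0.
move=> /(canRL (mulrK (valP b))); rewrite mul0r => /eqP.
by rewrite expr_p_eq0 leqNgt -ltn_subRL subKn // lt_uv.
Qed.

Lemma nonunit_dvdp (x : R) :
  x \isn't a GRing.unit -> exists y, x = P * y.
Proof.
have [[|u] [b [_ ->]]] := pexp_unitP x; first by rewrite mul1r (valP b).
by exists (P ^+ u * val b); rewrite mulrA -exprS.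
Qed.

Lemma p_nonunit : P \isn't a GRing.unit.
Proof. by rewrite natr_unit_pexp dvdnn. Qed.

(* [p]^u b = [p]^u c means that b and c are congruent modulo p^(e-u), so that *)
(* this is the "only if" half of the definition of the group A_(p^e).         *)
Definition pcompat (phi : U -> U) :=
  forall u (b c : U), P ^+ u * val b = P ^+ u * val c ->
    P ^+ u * val (phi b) = P ^+ u * val (phi c).

Lemma pcompat_expg t : pcompat (fun b => b ^+ t)%g.
Proof.
move=> u b c eq_bc; elim: t => [//|t IH].
rewrite !expgS !FinRing.val_unitM mulrA eq_bc mulrAC IH.
by rewrite mulrAC mulrA.
Qed.

(** The prescribed values are consistent: for u <= e the exponent is determined by the element, and
    [pcompat] makes the choice of the unit harmless; for u >= e everything is 0. *)
Lemma psi_exists (r : U) (phi : U -> U) :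
    {morph phi : b c / (b * c)%g} -> injective phi -> pcompat phi ->
  exists f : mulAut R, forall u b,
    f (P ^+ u * val b) = (P * val r) ^+ u * val (phi b).
Proof.
move=> phiM phiI phiC.
have exF (x : R) : exists y : R, forall u b,
    x = P ^+ u * val b -> y = (P * val r) ^+ u * val (phi b).
  have [u [b [le_u xE]]] := pexp_unitP x.
  exists ((P * val r) ^+ u * val (phi b)) => v c.
  have [le_v|/ltnW lt_v] := leqP v e.
    rewrite xE => eq_bc.
    have uv := pexp_unit_inj le_u le_v eq_bc; rewrite -uv in eq_bc *.
    rewrite exprMn_comm; last exact: mulrC.
    by rewrite mulrAC (phiC _ _ _ eq_bc) mulrAC.
  have /eqP Pv0 : P ^+ v == 0 by rewrite expr_p_eq0.
  have /eqP Pe0 : P ^+ e == 0 by rewrite expr_p_eq0.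
  rewrite Pv0 mul0r => x0.
  have -> : u = e.
    apply: (@pexp_unit_inj u e b 1%g) => //.
    by rewrite -xE x0 Pe0 mul0r.
  by rewrite !exprMn_comm ?Pv0 ?Pe0 ?mul0r //; exact: mulrC.
have [F FE] := fin_all_exists exF.
have {}FE u b : F (P ^+ u * val b) = (P * val r) ^+ u * val (phi b).
  exact: FE.
have phi_onto b : exists c, phi c = b.
  by exists (invF phiI b); rewrite f_invF.
(* On a finite ring it is enough that [F] is onto; the preimage of [p]^u b must compensate for the
   factor r^u. *)
have FI : injective F.
  have F_onto y : exists x, F x = y.
    have [u [b [_ ->]]] := pexp_unitP y.
    have [c cE] := phi_onto ((r ^+ u)^-1 * b)%g.
    exists (P ^+ u * val c); rewrite FE cE exprMn_comm; last exact: mulrC.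
    by rewrite -mulrA -FinRing.val_unitX -FinRing.val_unitM mulKVg.
  have [G GK] := fin_all_exists F_onto.
  by have GI : injective G := can_inj GK; apply: (can_inj (canF_sym GK)).
have FM : is_mulAut (perm FI).
  apply/is_mulAutP; split=> [|x y]; rewrite !permE.
    by have := FE 0 1%g; rewrite (morphM1 phiM) !expr0 !mulr1.
  have [u [b [_ ->]]] := pexp_unitP x; have [v [c [_ ->]]] := pexp_unitP y.
  rewrite mulrACA -exprD -FinRing.val_unitM !FE phiM FinRing.val_unitM exprD.
  by rewrite mulrACA.
by exists (MulAut FM) => u b; rewrite [LHS]permE FE.
Qed.

Implicit Types f g : mulAut R.

Lemma mulAut1 f : f 1 = 1.
Proof. by have [] := mulAut_monoid_morphism f. Qed.

Lemma mulAutMl f : {morph f : x y / x * y}.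
Proof. by have [] := mulAut_monoid_morphism f. Qed.

Lemma mulAutX f u : {morph f : x / x ^+ u}.
Proof.
move=> x; elim: u => [|u IH]; first exact: mulAut1.
by rewrite !exprS mulAutMl IH.
Qed.

Lemma mulAut_inj f : injective f.
Proof. exact: perm_inj. Qed.

Lemma mulAut_ext f g :
  f P = g P -> (forall b : U, f (val b) = g (val b)) -> f = g.
Proof.
move=> eqP eqU; apply/val_inj/permP=> x.
have [u [b [_ ->]]] := pexp_unitP x.
by rewrite !mulAutMl !mulAutX eqP eqU.
Qed.

Lemma mulAut_unit f (x : R) : x \is a GRing.unit -> f x \is a GRing.unit.
Proof.
move=> Ux; apply/unitrP; exists (f x^-1).
by rewrite -!mulAutMl mulVr // mulrV // mulAut1.
Qed.

Lemma mulAut_nonunit f (x : R) :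
  x \isn't a GRing.unit -> f x \isn't a GRing.unit.
Proof.
apply: contra => Ufx; have := mulAut_unit (f^-1)%g Ufx.
by rewrite -mulAutM mulVg [X in X \is a _]perm1.
Qed.

(** Both [f] and its inverse send [p] to multiples of [p], say [p] c and [p] d, so [p] = [p] c f(d).
    If c is not a unit, then 1 - c f(d) is one, which forces [p] = 0; any r will then do. *)
Lemma mulAut_p f : exists r : U, f P = P * val r.
Proof.
have [c fP] := nonunit_dvdp (mulAut_nonunit f p_nonunit).
have [d gP] := nonunit_dvdp (mulAut_nonunit (f^-1)%g p_nonunit).
have [Uc|nUc] := boolP (c \is a GRing.unit); first by exists (Sub c Uc).
exists 1%g; rewrite fP mulr1.
have : P = P * (c * f d).
  rewrite mulrA -fP -mulAutMl -gP -mulAutM mulgV.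
  by rewrite [RHS]perm1.
have [y cE] := nonunit_dvdp nUc.
have Uy : 1 - c * f d \is a GRing.unit.
  apply/negPn/negP => /nonunit_dvdp[z]; rewrite cE => /eqP.
  rewrite subr_eq -mulrA -mulrDr => /eqP E.
  have: P \is a GRing.unit.
      by apply/unitrP; exists (z + y * f d); rewrite mulrC -E.
  by apply/negP/p_nonunit.
move/eqP; rewrite -subr_eq0 -{1}[P]mulr1 -mulrBr => /eqP.
by move/(canRL (mulrK Uy)); rewrite mul0r => ->; rewrite !mul0r.
Qed.

Definition mulAut_res f (b : U) : U := Sub (f (val b)) (mulAut_unit f (valP b)).

Lemma val_mulAut_res f b : val (mulAut_res f b) = f (val b).
Proof. by []. Qed.

Lemma mulAut_resM f : {morph mulAut_res f : b c / (b * c)%g}.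
Proof. by move=> b c; apply: val_inj; rewrite /= mulAutMl. Qed.

Lemma mulAut_res_inj f : injective (mulAut_res f).
Proof. by move=> b c /(congr1 val) /mulAut_inj/val_inj. Qed.

(** Applying [f] multiplies [p]^u by the unit r^u, which cancels. Thus restrictions of automorphisms
    satisfy both halves of the condition defining A_(p^e). *)
Lemma mulAut_res_compat f u b c :
  P ^+ u * val b = P ^+ u * val c <->
  P ^+ u * val (mulAut_res f b) = P ^+ u * val (mulAut_res f c).
Proof.
have [r fP] := mulAut_p f.
have E x : f (P ^+ u * val x) = P ^+ u * val (mulAut_res f x) * val (r ^+ u)%g.
  by rewrite mulAutMl mulAutX fP exprMn FinRing.val_unitX mulrAC.
split=> [eq_bc|eq_bc].
  by apply: (mulIr (valP (r ^+ u)%g)); rewrite -!E eq_bc.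
by apply: (@mulAut_inj f); rewrite !E eq_bc.
Qed.

End PrimePower.

(** * Congruences, natural representatives and cyclicity of the units *)

Lemma intZ_eq0 (n : nat) (k : int) :
  (1 < n)%N -> ((k%:~R : 'Z_n) == 0) = (n %| `|k|)%N.
Proof.
move=> n_gt1; have E (j : nat) : ((j%:R : 'Z_n) == 0) = (n %| j)%N.
  by rewrite -(inj_eq val_inj) [X in X == _]val_Zp_nat.
by case: k => k; rewrite ?NegzE ?mulrNz ?oppr_eq0 ?abszN E.
Qed.

(** This is why r matters only modulo p^(e-1). The bound on e makes p^(e-1) > 1, so that the ring on
    the right really has this modulus. *)
Lemma mulp_eq (p e : nat) (i j : int) : prime p -> (2 <= e)%N ->
  (p%:R * i%:~R == p%:R * j%:~R :> 'Z_(p ^ e))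
    = (i%:~R == j%:~R :> 'Z_(p ^ (e - 1))).
Proof.
case: e => [|[|e]] // p_pr _; rewrite subn1 /=.
rewrite -subr_eq0 -mulrBr -[RHS]subr_eq0 -!intrB.
rewrite -[p%:R]/(p%:Z%:~R) -intrM !intZ_eq0 ?pexp_gt1 //.
by rewrite abszM expnS dvdn_pmul2l ?prime_gt0.
Qed.

Lemma intr_unit_pexp (p e : nat) (k : int) : prime p -> (0 < e)%N ->
  coprimez k p -> (k%:~R : 'Z_(p ^ e)) \is a GRing.unit.
Proof.
move=> p_pr e_gt0; rewrite coprimezE coprime_sym prime_coprime //=.
by case: k => k; rewrite ?NegzE ?mulrNz ?unitrN natr_unit_pexp ?abszN.
Qed.

Lemma unique_is_psi (p e : nat) (r : int) phi (f : mulAut 'Z_(p ^ e)) :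
  prime p -> (0 < e)%N -> is_psi p e r phi f -> unique (is_psi p e r phi) f.
Proof.
move=> p_pr e_gt0 psi_f; split=> // g psi_g; apply: (mulAut_ext p_pr e_gt0).
  by have := psi_f 1%N 1%g e_gt0; rewrite -psi_g // !mulr1.
by move=> b; have := psi_f 0%N b isT; rewrite -psi_g // !mul1r.
Qed.

Lemma coprime_unit_Zp (n : nat) (u : {unit 'Z_n}) :
  (1 < n)%N -> coprime n (val u : 'Z_n).
Proof. by move=> n_gt1; rewrite -unitZpE // natr_Zp (valP u). Qed.

Lemma sdZU_nat (m n : nat) (mn : Zdvd m n) (x y : sdZU mn) :
  (x * y)%g = (((x.1 : nat) + y.1 * (val x.2 : 'Z_n))%:R, (x.2 * y.2)%g).
Proof. by congr (_, _); rewrite natrD natrM !natr_Zp. Qed.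

Lemma ltn_Zp (m : nat) (x : 'Z_m) : (1 < m)%N -> (x < m)%N.
Proof. by move=> m_gt1; rewrite -[X in (_ < X)%N]Zp_cast. Qed.

Lemma Zp_natM (m : nat) (x y : 'Z_m) : x * y = ((x : nat) * y)%:R.
Proof. by rewrite natrM !natr_Zp. Qed.

(** For e = 1 these are the units of a prime field. For e >= 2 they form the automorphism group of a
    cyclic group of order p^e, which is cyclic for p odd. *)
Lemma unit_pexp_cyclic (p e : nat) : prime p -> odd p -> (0 < e)%N ->
  cyclic [set: {unit 'Z_(p ^ e)}].
Proof.
move=> p_pr p_odd; case: e => [//|[_|e _]].
  by rewrite expn1; apply: units_Zp_cyclic.
pose q := (p ^ e.+2)%N; have q_gt1 : (1 < q)%N by rewrite pexp_gt1.
pose a : 'Z_q := Zp1.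
have oa : #[a]%g = q by rewrite orderE -Zp_cycle cardsT card_ord Zp_cast.
rewrite -/q -[[set: _]]/(units_Zp _) -oa (isog_cyclic (Zp_unit_isog a)).
have pG : (p.-group <[a]>)%g by rewrite /pgroup -orderE oa pnatX pnat_id.
have ntG : (<[a]> != 1)%g by rewrite -cardG_gt1 -orderE oa.
have [m [_ _]] := cyclic_pgroup_Aut_structure pG (cycle_cyclic a) ntG.
rewrite ifN; last by rewrite -orderE oa pfactorK.
by case=> t [_ _ _]; rewrite p_odd => -[[]].
Qed.

(** * Odd p: automorphisms restrict to power maps on the units *)

Section OddPrime.

Variables (p e n : nat).
Hypotheses (p_pr : prime p) (p_odd : odd p) (e_gt0 : (0 < e)%N).
Hypothesis nE : n = (p ^ (e - 1) * p.-1)%N.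

Local Notation R := 'Z_(p ^ e).
Local Notation U := {unit R}.
Local Notation P := (p%:R : R).

Let q_gt1 : (1 < p ^ e)%N := pexp_gt1 p_pr e_gt0.

Let p_gt2 : (2 < p)%N.
Proof. exact: odd_prime_gt2. Qed.

Lemma card_unit_odd : #|[set: U]| = n.
Proof. by rewrite card_unit_pexp // nE subn1. Qed.

Lemma card_unit_odd_gt1 : (1 < n)%N.
Proof.
rewrite nE (@leq_trans p.-1) ?leq_pmull ?expn_gt0 ?prime_gt0 //.
by case: (p) p_gt2 => [|[|[]]].
Qed.

Lemma psi_odd_exists (r : U) (t : nat) : coprime n t ->
  exists f : mulAut R, forall u b,
    f (P ^+ u * val b) = (P * val r) ^+ u * val (chi_odd p e t b).
Proof.
move=> cot; apply: psi_exists => //; last exact: pcompat_expg.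
  by move=> b c; rewrite /chi_odd expgMn //; apply: unit_Zp_mulgC.
by apply: expg_coprime_inj; rewrite card_unit_odd.
Qed.

Lemma mulAut_expg (f : mulAut R) : exists2 t,
  coprime n t & forall b : U, f (val b) = val (chi_odd p e t b).
Proof.
have /cyclicP[g Ug] := unit_pexp_cyclic p_pr p_odd e_gt0.
have gP b : exists i, b = (g ^+ i)%g by apply/cycleP; rewrite -Ug inE.
have [t ft] := gP (mulAut_res f g).
have res_t b : mulAut_res f b = (b ^+ t)%g.
  by have [i ->] := gP b; rewrite (morphMX _ (mulAut_resM f)) ft expgAC.
exists t => [|b]; last by rewrite -val_mulAut_res res_t.
(* The restriction of [f] is onto, so g^t is again a generator; hence t is coprime to the order of
   the group. *)
rewrite -card_unit_odd Ug -orderE -generator_coprime.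
apply/eqP/setP=> b; rewrite -Ug inE; apply/esym/cycleP.
have [i cE] := gP (invF (@mulAut_res_inj _ _ f) b).
by exists i; rewrite -res_t -(morphMX _ (mulAut_resM f)) -cE f_invF.
Qed.

Lemma eq_expg_unit (i j : nat) :
  (forall b : U, b ^+ i = b ^+ j)%g -> i = j %[mod n].
Proof.
have /cyclicP[g Ug] := unit_pexp_cyclic p_pr p_odd e_gt0.
move/(_ g)/eqP; rewrite eq_expg_mod_order orderE -Ug card_unit_odd.
by move/eqP.
Qed.

Lemma expg_unit_mod (b : U) (k : nat) : (b ^+ (k%:R : 'Z_n) = b ^+ k)%g.
Proof.
rewrite val_Zp_nat ?card_unit_odd_gt1 // -card_unit_odd.
by apply: expg_mod; apply: expg_cardG; rewrite inE.
Qed.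

End OddPrime.

(** Here [p] = 0 carries no information, so the exponent on the units determines the automorphism.
    The proof works with p^1, which is convertible to p, to reuse the general lemmas. *)
Lemma mulAut_Zp_isog (p : nat) : prime p -> odd p ->
  [set: mulAut 'Z_p] \isog [set: {unit 'Z_(p.-1)}].
Proof.
move=> p_pr p_odd; set n := p.-1.
have e1_gt0 : (0 < 1)%N by [].
have nE : n = (p ^ (1 - 1) * p.-1)%N by rewrite mul1n.
have n_gt1 : (1 < n)%N by apply: (card_unit_odd_gt1 p_pr p_odd nE).
pose P (f : mulAut 'Z_(p ^ 1)) (v : {unit 'Z_n}) :=
  forall b : {unit 'Z_(p ^ 1)}, f (val b) = val (b ^+ (val v : 'Z_n))%g.
have p0 : p%:R = 0 :> 'Z_(p ^ 1) by apply: pchar_Zp; apply: prime_gt1.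
suff [F isoF _] : exists2 F, misom [set: mulAut 'Z_(p ^ 1)] [set: {unit 'Z_n}] F
    & forall f v, P f v -> F f = v by apply: misom_isog isoF.
apply: misom_of_rel => [f | v | f v w Pv Pw | f g v Pf Pg | f g v w Pf Pg b].
- have [t cot ft] := mulAut_expg p_pr p_odd e1_gt0 nE f.
  have cotz : coprimez t n by rewrite coprimezE /= coprime_sym.
  exists (unitZ n t) => b; rewrite val_unitZ // [t%:~R]/(t%:R).
  by rewrite (expg_unit_mod p_pr p_odd e1_gt0 nE) ft.
- have [f fE] := psi_odd_exists p_pr e1_gt0 nE 1%g (coprime_unit_Zp v n_gt1).
  by exists f => b; have := fE 0%N b; rewrite !mul1r.
- apply/val_inj/val_inj.
  have := @eq_expg_unit p 1 n p_pr p_odd e1_gt0 nE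
    (val v : 'Z_n) (val w : 'Z_n).
  rewrite !modn_small ?ltn_Zp //; apply=> b.
  by apply: val_inj; rewrite -Pv -Pw.
- apply: (mulAut_ext p_pr e1_gt0) => [|b]; last by rewrite Pf Pg.
  have [r ->] := mulAut_p p_pr e1_gt0 f; have [s ->] := mulAut_p p_pr e1_gt0 g.
  by rewrite p0 !mul0r.
- rewrite mulAutM Pg Pf -expgM mulnC FinRing.val_unitM Zp_natM.
  by rewrite (expg_unit_mod p_pr p_odd e1_gt0 nE).
Qed.

(** * Odd p and e >= 2: the semidirect product *)

Section OddPrimePower.

Variables (p e : nat).
Hypotheses (p_pr : prime p) (p_odd : odd p) (e_ge2 : (2 <= e)%N).

Local Notation m := (p ^ (e - 2) * p.-1)%N.
Local Notation n := (p ^ (e - 1) * p.-1)%N.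
Local Notation S := (sdZU (Zdvd_odd p e)).

Let e_gt0 : (0 < e)%N. Proof. exact: ltnW. Qed.
Let e1_gt0 : (0 < e - 1)%N. Proof. by rewrite subn_gt0. Qed.
Let mE : m = (p ^ (e - 1 - 1) * p.-1)%N. Proof. by rewrite -subnDA. Qed.
Let m_gt1 : (1 < m)%N. Proof. exact: (card_unit_odd_gt1 p_pr p_odd mE). Qed.
Let n_gt1 : (1 < n)%N. Proof. exact: (card_unit_odd_gt1 p_pr p_odd erefl). Qed.

Lemma mulAut_odd_misom (a : {unit 'Z_(p ^ (e - 1))}) :
    generator [set: {unit 'Z_(p ^ (e - 1))}] a ->
  exists2 F : mulAut 'Z_(p ^ e) -> S,
    misom [set: mulAut 'Z_(p ^ e)] [set: S] F
  & forall (r : int) (t : nat) (s : int),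
      coprimez r p -> (t < n)%N -> coprime t n ->
      (r%:~R : 'Z_(p ^ (e - 1))) = val a ^ s ->
      exists f : mulAut 'Z_(p ^ e),
        unique (is_psi p e r (chi_odd p e t)) f /\ F f = (s%:~R, unitZ n t).
Proof.
move=> /eqP Ua; have oa : #[a]%g = m.
  by rewrite orderE -Ua (card_unit_odd p_pr e1_gt0 mE).
(* [A] lifts a to Z/p^e. The lift is not canonical, but [p] A^i depends only on a^i, which is what
   [eq_pA] records. *)
pose A := (val a : 'Z_(p ^ (e - 1))) : nat.
have AE k : A%:R ^+ k = val (a ^+ k)%g :> 'Z_(p ^ (e - 1)).
  by rewrite natr_Zp FinRing.val_unitX.
have amod k : (a ^+ (k%:R : 'Z_m) = a ^+ k)%g.
  by rewrite val_Zp_nat // -oa expg_mod_order.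
have eq_pA i j : p%:R * A%:R ^+ i = p%:R * A%:R ^+ j :> 'Z_(p ^ e) <->
    (a ^+ i = a ^+ j)%g.
  rewrite -!natrX; split=> [/eqP|eq_a]; last apply/eqP.
    rewrite (mulp_eq (A ^ i)%N (A ^ j)%N) // => /eqP eq_A.
    by apply: val_inj; rewrite -!AE -!natrX.
  by rewrite (mulp_eq (A ^ i)%N (A ^ j)%N) // -!pmulrn !natrX !AE eq_a.
pose P (f : mulAut 'Z_(p ^ e)) (x : S) :=
  f p%:R = p%:R * A%:R ^+ x.1
  /\ forall b : {unit 'Z_(p ^ e)}, f (val b) = val (b ^+ (val x.2 : 'Z_n))%g.
have Punit (f : mulAut 'Z_(p ^ e)) (s : nat) (t : int) : coprimez t n ->
    f p%:R = p%:R * A%:R ^+ s ->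
    (forall b : {unit 'Z_(p ^ e)}, f (val b) = val b ^+ (t%:~R : 'Z_n)) ->
  P f (s%:R, unitZ n t).
  move=> cot fp fU; split=> [|b] /=.
    by rewrite fp; apply/eq_pA; rewrite amod.
  by rewrite val_unitZ // fU FinRing.val_unitX.
have UA : (A%:R : 'Z_(p ^ e)) \is a GRing.unit.
  by rewrite natr_unit_pexp // -unit_pexpE //; exact: valP.
suff [F isoF FP] : exists2 F, misom [set: mulAut 'Z_(p ^ e)] [set: S] F
    & forall f x, P f x -> F f = x.
  exists F => // r t s cor _ cot rE.
  have Ur : (r%:~R : 'Z_(p ^ e)) \is a GRing.unit.
    exact: intr_unit_pexp.
  have [|f fE] := psi_odd_exists p_pr e_gt0 erefl (FinRing.unit _ Ur) (t := t).
    by rewrite coprime_sym.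
  exists f; split.
    apply: unique_is_psi => // u b _.
    by rewrite fE intrM.
  apply: FP; have ok : val a ^+ m = 1 :> 'Z_(p ^ (e - 1)).
    by rewrite -FinRing.val_unitX -oa expg_order.
  rewrite -[s%:~R]natr_Zp; apply: Punit.
  + by rewrite coprimezE.
  + have := fE 1%N 1%g; rewrite /chi_odd expg1n !expr1 !mulr1 => ->.
    apply/eqP; rewrite -natrX (mulp_eq r (A ^ _)%N) // rE -pmulrn natrX natr_Zp.
    by rewrite (exprz_Zp _ m_gt1 ok).
  + move=> b; have := fE 0%N b; rewrite !mul1r => ->.
    rewrite /chi_odd [t%:~R]/(t%:R) -FinRing.val_unitX.
    by rewrite (expg_unit_mod p_pr p_odd e_gt0 erefl).
apply: misom_of_rel => [f | x | f x y [Px1 Px2] [Py1 Py2]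
    | f g x [Pf1 Pf2] [Pg1 Pg2] | f g x y [Pf1 Pf2] [Pg1 Pg2]].
- have [t cot ft] := mulAut_expg p_pr p_odd e_gt0 erefl f.
  have [r fp] := mulAut_p p_pr e_gt0 f.
  pose r' : 'Z_(p ^ (e - 1)) := (val r : 'Z_(p ^ e))%:R.
  have Ur' : r' \is a GRing.unit.
    by rewrite natr_unit_pexp // -unit_pexpE //; exact: valP.
  have /cycleP[s sE] : FinRing.unit _ Ur' \in <[a]>%g by rewrite -Ua inE.
  exists (s%:R, unitZ n t); apply: Punit.
  + by rewrite coprimezE /= coprime_sym.
  + rewrite fp -[val r]natr_Zp -natrX; apply/eqP.
    rewrite (mulp_eq (val r : 'Z_(p ^ e))%N (A ^ s)%N) //.
    by rewrite -!pmulrn natrX AE -sE.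
  + move=> b; rewrite ft -FinRing.val_unitX.
    by rewrite (expg_unit_mod p_pr p_odd e_gt0 erefl).
- have cot := coprime_unit_Zp x.2 n_gt1.
  have [f fE] :=
    psi_odd_exists p_pr e_gt0 erefl (FinRing.unit _ UA ^+ x.1)%g cot.
  exists f; split=> [|b]; last by have := fE 0%N b; rewrite !mul1r.
  have := fE 1%N 1%g; rewrite /chi_odd expg1n !expr1 !mulr1 => ->.
  by rewrite FinRing.val_unitX.
- case: x y Px1 Px2 Py1 Py2 => [x1 x2] [y1 y2] /= Px1 Px2 Py1 Py2.
  congr (_, _); apply/val_inj; last apply/val_inj.
    have /eqP : (a ^+ x1 = a ^+ y1)%g by apply/eq_pA; rewrite -Px1 -Py1.
    rewrite eq_expg_mod_order oa => /eqP.
    by rewrite !modn_small ?ltn_Zp.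
  have := @eq_expg_unit p e n p_pr p_odd e_gt0 erefl
    (val x2 : 'Z_n) (val y2 : 'Z_n).
  rewrite !modn_small ?ltn_Zp //; apply=> b.
  exact/val_inj/(etrans (esym (Px2 b)) (Py2 b)).
- apply: (mulAut_ext p_pr e_gt0) => [|b]; first by rewrite Pf1 Pg1.
  by rewrite Pf2 Pg2.
(* On [p] the composite gives [p] A^(x.1) (A^(y.1))^(x.2), whence the twisted sum x.1 + y.1 x.2 of
   the first coordinates. *)
- rewrite sdZU_nat; split=> [|b].
    rewrite mulAutM Pg1 mulAutMl mulAutX Pf1 (Pf2 (FinRing.unit _ UA)).
    rewrite FinRing.val_unitX -exprM -mulrA -exprD [(_ * y.1)%N]mulnC.
    by apply/eq_pA; rewrite amod.
  rewrite mulAutM Pg2 Pf2 -expgM mulnC FinRing.val_unitM Zp_natM.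
  by rewrite (expg_unit_mod p_pr p_odd e_gt0 erefl).
Qed.

End OddPrimePower.

(** Squaring 1 + 2^(k+2) d with d odd gives 1 + 2^(k+3) (d + 2^(k+1) d^2), whose cofactor is again
    odd. The exact power of 2 yields both the order of 5 and the identity 2 z = 2. *)
Lemma exp5_pow2 (k : nat) :
  exists c, (5 ^ (2 ^ k) = 1 + 2 ^ (k + 2) * c.*2.+1)%N.
Proof.
elim: k => [|k [c IH]]; first by exists 0%N.
exists (c + 2 ^ k * c.*2.+1 ^ 2)%N.
rewrite expnSr expnM IH -[RHS]addn1 sqrnD.
have -> : (2 ^ (k.+1 + 2) = 2 * 2 ^ (k + 2))%N by rewrite -expnS.
by rewrite -!muln2 expnD; ring.
Qed.

(** * The units modulo 2^e as the product of <-1> and <5> *)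

Section TwoPower.

Variable e : nat.
Hypothesis e_ge2 : (2 <= e)%N.

Local Notation R := 'Z_(2 ^ e).
Local Notation U := {unit R}.
Local Notation P := (2%:R : R).
Local Notation neg1 := (unitZ (2 ^ e) (-1)).
Local Notation five := (unitZ (2 ^ e) 5).

Let e_gt0 : (0 < e)%N. Proof. exact: ltnW. Qed.
Let p_pr : prime 2. Proof. by []. Qed.
Let q_gt1 : (1 < 2 ^ e)%N := pexp_gt1 p_pr e_gt0.

Lemma val_neg1 : val neg1 = -1.
Proof. by rewrite val_unitZ // coprimezE coprime1n. Qed.

Lemma val_five : val five = 5%:R.
Proof. by rewrite val_unitZ // coprimezE /= coprimeXr. Qed.

Lemma neg1_sqr : (neg1 ^+ 2 = 1)%g.
Proof. by apply: val_inj; rewrite FinRing.val_unitX val_neg1 sqrrN expr1n. Qed.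

Lemma neg1X_odd k : (neg1 ^+ k = neg1 ^+ odd k)%g.
Proof. by rewrite -(expg_mod k neg1_sqr) modn2. Qed.

Lemma five_pow2 : (five ^+ (2 ^ (e - 2)) = 1)%g.
Proof.
apply: val_inj; rewrite FinRing.val_unitX val_five -natrX.
have [c ->] := exp5_pow2 (e - 2); rewrite subnK // natrD natrM natrX.
by have /eqP-> : P ^+ e == 0; rewrite ?expr_p_eq0 // mul0r addr0.
Qed.

(* Multiplication by 2^(e-2) in Z/2^e only depends on classes modulo 4.       *)
Definition is_3mod4 (b : U) : bool := P ^+ (e - 2) * val b != P ^+ (e - 2).

(** Since 5 = 1 + 2^2, multiplication by 5 fixes 2^(e-2), whereas -1 moves it because 2^(e-1) is
    nonzero. *)
Lemma is_3mod4E i j : is_3mod4 (neg1 ^+ i * five ^+ j)%g = odd i.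
Proof.
have P5 : P ^+ (e - 2) * val (five ^+ j)%g = P ^+ (e - 2).
  elim: j => [|j IH]; first by rewrite mulr1.
  rewrite expgSr FinRing.val_unitM mulrA IH val_five (_ : 5%:R = 1 + P ^+ 2) //.
    rewrite mulrDr mulr1 -exprD subnK //.
    by have /eqP-> : P ^+ e == 0; rewrite ?expr_p_eq0 // addr0.
  by rewrite -natrX -(natrD _ 1).
rewrite /is_3mod4 FinRing.val_unitM mulrCA P5 FinRing.val_unitX val_neg1.
rewrite -signr_odd; case: odd; last by rewrite mul1r eqxx.
rewrite mulN1r eq_sym -subr_eq0 opprK -mulr2n -(mulr_natr (P ^+ _)) -exprSr.
by rewrite expr_p_eq0 // -subSn // subSS leqNgt ltn_subrL e_gt0.
Qed.

(** For e >= 3, 5^(2^(e-3)) is 1 plus an odd multiple of 2^(e-1), hence is not 1, although its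
    square is. For e = 2 the class of 5 is 1. *)
Lemma five_order : #[five]%g = (2 ^ (e - 2))%N.
Proof.
have := e_ge2; rewrite leq_eqVlt => /predU1P[e2|e_ge3].
  have e0 : (e - 2 = 0)%N by rewrite -e2.
  by have := five_pow2; rewrite e0 expn0 expg1 => ->; rewrite order1.
have e2 : (e - 2 = (e - 3).+1)%N by rewrite -subSn // subSS.
pose z := (five ^+ (2 ^ (e - 3)))%g; rewrite e2 expnSr.
apply: orderXpfactor => //; apply: nt_prime_order => //.
  by rewrite -expgM -expnSr -e2 five_pow2.
apply/eqP=> /(congr1 val)/eqP; rewrite FinRing.val_unitX val_five -natrX.
have [c ->] := exp5_pow2 (e - 3).
rewrite natrD -subr_eq0 addrAC subrr add0r natrM natrX.
have Uw : ((c.*2.+1)%:R : R) \is a GRing.unit.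
  by rewrite natr_unit_pexp // dvdn2 /= odd_double.
rewrite -(mul0r (c.*2.+1)%:R) (inj_eq (mulIr Uw)) expr_p_eq0 //.
by rewrite addn2 -e2 -subSn // subSS leqNgt ltn_subrL e_gt0.
Qed.

Lemma neg1_five_inj i j k l :
    (neg1 ^+ i * five ^+ j = neg1 ^+ k * five ^+ l)%g ->
  odd i = odd k /\ j = l %[mod 2 ^ (e - 2)].
Proof.
move=> eq_ij; have odd_ik : odd i = odd k.
  by rewrite -(is_3mod4E i j) eq_ij is_3mod4E.
split=> //; apply/eqP; rewrite -five_order -eq_expg_mod_order.
by move: eq_ij; rewrite neg1X_odd (neg1X_odd k) odd_ik => /mulgI->.
Qed.

(** By counting: the 2 * 2^(e-2) products are distinct, and there are 2^(e-1) units. *)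
Lemma neg1_five_gen (b : U) : exists i j, b = (neg1 ^+ i * five ^+ j)%g.
Proof.
pose h (x : 'I_2 * 'I_(2 ^ (e - 2))) := (neg1 ^+ x.1 * five ^+ x.2)%g.
have h_inj : injective h.
  case=> [i j] [k l] /neg1_five_inj[odd_ik] /=.
  rewrite !modn_small // => /val_inj->; congr (_, _); apply: val_inj.
  by case: i k odd_ik => [[|[|]]] // ? [[|[|]]].
have /codomP[[i j] ->] : b \in codom h; last by exists i, j.
apply: inj_card_onto h_inj _ _; rewrite -cardsT card_unit_pexp // muln1.
by rewrite card_prod !card_ord -expnS -subSn // subSS subn1.
Qed.

Lemma eq_on_neg1_five (A : finGroupType) (phi psi : U -> A) :
    {morph phi : b c / (b * c)%g} -> {morph psi : b c / (b * c)%g} ->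
  phi neg1 = psi neg1 -> phi five = psi five -> phi =1 psi.
Proof.
move=> phiM psiM eq1 eq5 b; have [i [j ->]] := neg1_five_gen b.
by rewrite phiM psiM !(morphMX _ phiM) !(morphMX _ psiM) eq1 eq5.
Qed.


Hypothesis e_ge3 : (3 <= e)%N.

(** This is the class of 1 + 2^(e-1), the nontrivial unit congruent to 1 modulo 2^(e-1). *)
Definition zeta : U := (five ^+ (2 ^ (e - 3)))%g.
Local Notation z := zeta.

Let e2E : (e - 2 = (e - 3).+1)%N. Proof. by rewrite -subSn // subSS. Qed.

Lemma is_3mod4M b c : is_3mod4 (b * c)%g = is_3mod4 b (+) is_3mod4 c.
Proof.
have [i [j ->]] := neg1_five_gen b; have [k [l ->]] := neg1_five_gen c.
rewrite mulgA -(mulgA _ (five ^+ j)%g) [(five ^+ j * _)%g]unit_Zp_mulgC mulgA.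
by rewrite -expgD -mulgA -expgD !is_3mod4E oddD.
Qed.

Lemma is_3mod4X b k : is_3mod4 (b ^+ k)%g = odd k && is_3mod4 b.
Proof.
elim: k => [|k IH]; first by have := is_3mod4E 0 0; rewrite !expg0 mulg1.
by rewrite expgS is_3mod4M IH /=; case: odd; case: is_3mod4.
Qed.

Lemma is_3mod4_five : is_3mod4 five = false.
Proof. by have := is_3mod4E 0 1; rewrite expg0 mul1g expg1. Qed.

Lemma is_3mod4_neg1 : is_3mod4 neg1.
Proof. by have := is_3mod4E 1 0; rewrite expg0 mulg1 expg1 => ->. Qed.

Lemma zetaX_mod k : (z ^+ k = z ^+ odd k)%g.
Proof.
have z2 : (z ^+ 2 = 1)%g by rewrite -expgM -expnSr -e2E five_pow2.
by rewrite -(expg_mod k z2) modn2.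
Qed.

Lemma mul2_zetaX k : P * val (z ^+ k)%g = P.
Proof.
have Pz : P * val z = P.
  rewrite FinRing.val_unitX val_five -natrX; have [c ->] := exp5_pow2 (e - 3).
  rewrite natrD natrM natrX mulrDr mulr1 mulrA -exprS addn2 -e2E -subSn //.
  rewrite subSS.
  rewrite -subSn ?(ltnW e_ge2) // subSS subn0.
  by have /eqP-> : P ^+ e == 0; rewrite ?expr_p_eq0 // mul0r addr0.
elim: k => [|k IH]; first by rewrite mulr1.
by rewrite expgS FinRing.val_unitM mulrA Pz.
Qed.

(* The automorphism chi_(2^e, (s 2^(e-3), 0, t)). *)
Definition chi2 (s t : nat) (b : U) : U := (b ^+ t * z ^+ (s * is_3mod4 b))%g.

(** * The automorphisms of the units modulo 2^e that extend to the monoid *)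

Section Chi2.

Variables (s t : nat).
Hypothesis t_odd : odd t.

Lemma chi2M : {morph chi2 s t : b c / (b * c)%g}.
Proof.
move=> b c; rewrite /chi2 expgMn; last exact: unit_Zp_mulgC.
rewrite -!mulgA; congr (_ * _)%g.
rewrite [RHS]mulgA [(_ * c ^+ t)%g]unit_Zp_mulgC -mulgA -expgD -mulnDr.
congr (_ * _)%g; rewrite zetaX_mod [RHS]zetaX_mod !oddM oddD is_3mod4M.
by case: is_3mod4; case: is_3mod4.
Qed.

(** As t is odd and z is a power of 5, [chi2] preserves the class modulo 4. Equal images thus have
    equal factors z^(...), which cancel and leave an injective power map. *)
Lemma chi2_inj : injective (chi2 s t).
Proof.
have sgE b : is_3mod4 (chi2 s t b) = is_3mod4 b.
  by rewrite is_3mod4M !is_3mod4X t_odd is_3mod4_five !andbF addbF.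
move=> b c eq_bc; have sg_bc : is_3mod4 b = is_3mod4 c.
  by rewrite -(sgE b) -(sgE c) eq_bc.
move: eq_bc; rewrite /chi2 sg_bc => /mulIg; apply: expg_coprime_inj.
by rewrite card_unit_pexp // muln1 coprimeXl // coprime2n.
Qed.

(** For u > 0 a factor 2 absorbs the power of z, and a power map remains. *)
Lemma chi2_compat : pcompat (chi2 s t).
Proof.
move=> [|u] b c eq_bc; first by move: eq_bc; rewrite !mul1r => /val_inj->.
have E x k : P ^+ u.+1 * val (x * z ^+ k)%g = P ^+ u.+1 * val x.
  rewrite FinRing.val_unitM mulrCA exprSr -!(mulrA _ P) mul2_zetaX.
  by rewrite mulrC mulrA.
by rewrite !E; apply: pcompat_expg eq_bc.
Qed.

Lemma chi2_neg1 : chi2 s t neg1 = (neg1 * z ^+ s)%g.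
Proof.
rewrite /chi2 is_3mod4_neg1 muln1; congr (_ * _)%g.
by rewrite neg1X_odd t_odd.
Qed.

Lemma chi2_five : chi2 s t five = (five ^+ t)%g.
Proof. by rewrite /chi2 is_3mod4_five muln0 mulg1. Qed.

Lemma psi_two_exists (r : U) : exists f : mulAut R, forall u b,
  f (P ^+ u * val b) = (P * val r) ^+ u * val (chi2 s t b).
Proof.
by apply: psi_exists => //;
  [exact: chi2M | exact: chi2_inj | exact: chi2_compat].
Qed.

(** Here k is the parameter t1 of the triple, tied to s by 5^k = z^s. Uniqueness holds because -1
    and 5 generate the units. *)
Lemma is_chi2_unique (k : nat) : (five ^+ k = z ^+ s)%g ->
  exists chi : {perm U}, chi =1 chi2 s t /\ unique (is_chi2 e (k, 0%N, t)) chi.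
Proof.
move=> kE; have chiE : perm chi2_inj =1 chi2 s t by move=> b; rewrite permE.
exists (perm chi2_inj); split=> //; split.
  split; last 2 first.
  - by rewrite chiE chi2_neg1 kE.
  - by rewrite chiE chi2_five expg0 mul1g.
  rewrite inE; apply/andP; split; first by apply/subsetP=> b; rewrite inE.
  by apply/morphicP=> b c _ _; rewrite !chiE chi2M.
move=> chi [chiA chi1 chi5]; apply/permP/eq_on_neg1_five.
- by move=> b c; rewrite !chiE chi2M.
- by move=> b c; apply: (morphicP (Aut_morphic chiA)); rewrite inE.
- by rewrite chi1 chiE chi2_neg1 kE.
- by rewrite chi5 chiE chi2_five expg0 mul1g.
Qed.

End Chi2.

(* f is psi_(r, chi), r = (-1)^u 5^v and chi = chi_(2^e, (s 2^(e-3), 0, t)).  *)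
Definition psi2 (f : mulAut R) (u s v t : nat) : Prop :=
  [/\ f P = P * val (neg1 ^+ u * five ^+ v)%g,
      f (val neg1) = val (neg1 * z ^+ s)%g & f (val five) = val (five ^+ t)%g].

Lemma psi2_exists u s v t : odd t -> exists f, psi2 f u s v t.
Proof.
move=> t_odd; have [f fE] := psi_two_exists s t_odd (neg1 ^+ u * five ^+ v)%g.
exists f; split.
- have := fE 1%N 1%g; rewrite expr1 !mulr1 => ->; rewrite expr1.
  by rewrite (morphM1 (chi2M s t)) mulr1.
- by have := fE 0%N neg1; rewrite !mul1r chi2_neg1.
- by have := fE 0%N five; rewrite !mul1r chi2_five.
Qed.

Lemma psi2_ext f g u s v t : psi2 f u s v t -> psi2 g u s v t -> f = g.
Proof.
case=> [fP f1 f5] [gP g1 g5]; apply: (mulAut_ext p_pr e_gt0) => [|b].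
  by rewrite fP gP.
rewrite -!val_mulAut_res; congr val; move: b.
by apply: eq_on_neg1_five; try exact: mulAut_resM; apply: val_inj;
   rewrite /= ?f1 ?g1 ?f5 ?g5.
Qed.

Implicit Types f g : mulAut R.

Lemma mulAut_val_prod f (b c : U) : f (val (b * c)%g) = f (val b) * f (val c).
Proof. by rewrite FinRing.val_unitM mulAutMl. Qed.

Lemma mulAut_val_exp f (b c : U) k :
  f (val b) = val c -> f (val (b ^+ k)%g) = val (c ^+ k)%g.
Proof. by move=> fb; rewrite !FinRing.val_unitX mulAutX fb. Qed.

(** By [mulAut_res_compat] at exponent e - 2, [f] preserves the class modulo 4. So it sends 5 to
    some 5^t and -1 to some -5^k. *)
Lemma psi2_total f : exists u s v t, odd t /\ psi2 f u s v t.
Proof.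
have [r fP] := mulAut_p p_pr e_gt0 f; have [u [v rE]] := neg1_five_gen r.
have sgE b : is_3mod4 (mulAut_res f b) = is_3mod4 b.
  have := mulAut_res_compat p_pr e_gt0 f (e - 2) b 1%g.
  rewrite (morphM1 (mulAut_resM f)) mulr1 /is_3mod4 => eq_b; congr (~~ _).
  by apply/eqP/eqP=> /eq_b.
have [i [t f5]] := neg1_five_gen (mulAut_res f five).
have [j [k f1]] := neg1_five_gen (mulAut_res f neg1).
have i_even : odd i = false by rewrite -(is_3mod4E i t) -f5 sgE is_3mod4_five.
have j_odd : odd j = true by rewrite -(is_3mod4E j k) -f1 sgE is_3mod4_neg1.
rewrite neg1X_odd i_even expg0 mul1g in f5; rewrite neg1X_odd j_odd expg1 in f1.
have t_odd : odd t.
  (* If t were even, [f] would send z to 5^(t 2^(e-3)) = 1, against injectivity. *)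
  apply/negPn/negP=> t_even; have : z = 1%g; last first.
    move/eqP; rewrite -order_dvdn five_order e2E dvdn_Pexp2l //.
    by rewrite ltnn.
  apply: (@mulAut_res_inj _ _ f); apply: val_inj.
  rewrite !val_mulAut_res mulAut1.
  apply: etrans (mulAut_val_exp _ (congr1 val f5)) _.
  rewrite -expgM -[t]odd_double_half (negPf t_even) add0n -muln2 -mulnA -expnS.
  by rewrite -e2E mulnC expgM five_pow2 expg1n.
(* The square of f(-1) is 1, so 2^(e-3) divides k; the quotient is the parameter s. *)
have : (five ^+ (k * 2) = 1)%g.
  have : (1 = (neg1 * five ^+ k) ^+ 2)%g.
    apply: val_inj; rewrite -[LHS](mulAut1 f) -[1 in LHS]/(val (1%g : U)).
    rewrite -neg1_sqr; apply: mulAut_val_exp; exact: (congr1 val f1).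
  rewrite expgMn; last exact: unit_Zp_mulgC.
  by rewrite neg1_sqr mul1g -expgM => <-.
move/eqP; rewrite -order_dvdn five_order e2E expnSr dvdn_pmul2r //.
move=> /dvdnP[s kE].
exists u, s, v, t; split=> //; split; first by rewrite fP rE.
  by rewrite -val_mulAut_res f1 kE mulnC expgM.
by rewrite -val_mulAut_res f5.
Qed.

Lemma psi2M f g u s v t u' s' v' t' : odd t ->
    psi2 f u s v t -> psi2 g u' s' v' t' ->
  psi2 (f * g)%g (u + u') (s + s') (v + v' * t) (t * t').
Proof.
move=> t_odd [fP f1 f5] [gP g1 g5]; split; rewrite mulAutM.
- rewrite gP mulAutMl fP mulAut_val_prod.
  rewrite (mulAut_val_exp _ f1) (mulAut_val_exp _ f5).
  (* The image of (-1)^u' contributes z^(s u'), which the factor 2 absorbs; hence s does not affect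
     the first coordinate. *)
  rewrite -[in RHS](mul2_zetaX (s * u')) !FinRing.val_unitM !FinRing.val_unitX.
  rewrite FinRing.val_unitM !FinRing.val_unitX exprMn -!exprM !exprD.
  by rewrite mulnA (mulnC t v'); ring.
- rewrite g1 mulAut_val_prod f1.
  have fz : f (val z) = val (z ^+ t)%g.
    by rewrite (mulAut_val_exp _ f5) -!expgM mulnC.
  rewrite (mulAut_val_exp _ fz) -FinRing.val_unitM -mulgA -(expgM z) -(expgD z).
  by rewrite [in LHS]zetaX_mod [in RHS]zetaX_mod !oddD oddM t_odd.
- by rewrite g5 (mulAut_val_exp _ f5) -expgM.
Qed.

(** These congruences describe when two quadruples give the same automorphism. The modulus for v is
    2^(e-3), the order of 5 modulo 2^(e-1), since r matters only modulo 2^(e-1). *)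
Definition psi2_eq (u s v t u' s' v' t' : nat) : Prop :=
  [/\ odd u = odd u', odd s = odd s', v = v' %[mod 2 ^ (e - 3)]
    & t = t' %[mod 2 ^ (e - 2)]].

Lemma psi2_cong f u s v t u' s' v' t' :
  psi2_eq u s v t u' s' v' t' -> psi2 f u s v t -> psi2 f u' s' v' t'.
Proof.
case=> eq_u eq_s eq_v eq_t [fP f1 f5]; split.
- have P5 k : P * val (five ^+ k)%g = P * val (five ^+ (k %% 2 ^ (e - 3)))%g.
    rewrite {1}(divn_eq k (2 ^ (e - 3))) expgD mulnC expgM.
    by rewrite FinRing.val_unitM mulrA mul2_zetaX.
  rewrite fP neg1X_odd eq_u -neg1X_odd !FinRing.val_unitM mulrCA P5 eq_v -P5.
  by rewrite mulrCA.
- by rewrite f1 zetaX_mod eq_s -zetaX_mod.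
- rewrite f5; congr val; apply/eqP; rewrite eq_expg_mod_order five_order.
  exact/eqP.
Qed.

Lemma val_neg1_five u v :
  val (neg1 ^+ u * five ^+ v)%g = ((-1) ^+ u * 5%:Z ^+ v)%:~R.
Proof.
rewrite FinRing.val_unitM !FinRing.val_unitX val_neg1 val_five.
by rewrite rmorphM !rmorphXn.
Qed.

End TwoPower.

(** * From the parameters u, s, v, t to group isomorphisms *)

Section TwoPowerIso.

Variable e : nat.
Hypothesis e_ge3 : (3 <= e)%N.

Let e_ge2 : (2 <= e)%N. Proof. exact: ltnW. Qed.
Let e1_ge2 : (2 <= e - 1)%N. Proof. by rewrite ltn_subRL. Qed.

Lemma psi2_fun (f : mulAut 'Z_(2 ^ e)) u s v t u' s' v' t' :
  psi2 f u s v t -> psi2 f u' s' v' t' -> psi2_eq e u s v t u' s' v' t'.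
Proof.
case=> [fP f1 f5] [gP g1 g5].
(* Cancelling the factor 2 leaves an equality modulo 2^(e-1), where the decomposition into powers of
   -1 and 5 is applied again. *)
have : (unitZ (2 ^ (e - 1)) (-1) ^+ u * unitZ (2 ^ (e - 1)) 5 ^+ v
   = unitZ (2 ^ (e - 1)) (-1) ^+ u' * unitZ (2 ^ (e - 1)) 5 ^+ v')%g.
  apply: val_inj; rewrite !val_neg1_five //; apply/eqP; rewrite -mulp_eq //.
  by rewrite -!val_neg1_five // -fP -gP.
case/neg1_five_inj=> // odd_u eq_v; split=> //.
- move: f1; rewrite g1 => /val_inj/mulgI/eqP.
  rewrite -!expgM eq_expg_mod_order five_order //.
  rewrite (_ : e - 2 = (e - 3).+1)%N; last by rewrite -subSn // subSS.
  by rewrite expnSr -!muln_modr eqn_pmul2l ?expn_gt0 // !modn2; do 2!case: odd.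
- by rewrite -subnDA in eq_v.
- move: f5; rewrite g5 => /val_inj/eqP.
  by rewrite eq_expg_mod_order five_order // => /eqP.
Qed.

Lemma psi2_misom (rT : finGroupType) (u s v t : rT -> nat) :
    (forall x, odd (t x)) ->
    (forall i j k l, odd l ->
       exists x, psi2_eq e i j k l (u x) (s x) (v x) (t x)) ->
    (forall x y, psi2_eq e (u x) (s x) (v x) (t x) (u y) (s y) (v y) (t y) ->
       x = y) ->
    (forall x y, psi2_eq e (u x + u y) (s x + s y) (v x + v y * t x) (t x * t y)
       (u (x * y)%g) (s (x * y)%g) (v (x * y)%g) (t (x * y)%g)) ->
  exists2 F : mulAut 'Z_(2 ^ e) -> rT,
    misom [set: mulAut 'Z_(2 ^ e)] [set: rT] F
  & forall f x, psi2 f (u x) (s x) (v x) (t x) -> F f = x.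
Proof.
move=> t_odd onto inj mul.
apply: misom_of_rel => [f | x | f x y Px Py | f g x Pf Pg | f g x y Pf Pg].
- have [i [j [k [l [l_odd Pf]]]]] := psi2_total e_ge2 e_ge3 f.
  have [x Px] := onto i j k l l_odd.
  by exists x; apply: psi2_cong Px Pf.
- exact: psi2_exists.
- exact: inj (psi2_fun Px Py).
- exact: psi2_ext Pf Pg.
- by apply: psi2_cong (mul x y) _ => //; apply: psi2M.
Qed.

End TwoPowerIso.

(** * The concrete groups for p = 2, and cardinalities *)

Lemma odd_Z2D (x y : 'Z_2) : odd (x + y)%R = odd x (+) odd y.
Proof. by rewrite odd_mod // oddD. Qed.

Lemma odd_Z2_nat (k : nat) : odd (k%:R : 'Z_2) = odd k.
Proof. by rewrite val_Zp_nat // odd_mod. Qed.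

Lemma odd_Z2_inj : injective (fun x : 'Z_2 => odd x).
Proof. by move=> [[|[|]]] // ? [[|[|]]] // ? _; apply: val_inj. Qed.

Lemma mod_Zp_nat (m k : nat) : (1 < m)%N -> (k%:R : 'Z_m) = k %[mod m].
Proof. by move=> m_gt1; rewrite val_Zp_nat // modn_mod. Qed.

Lemma mod_Zp_inj (m : nat) (x y : 'Z_m) : (1 < m)%N -> x = y %[mod m] -> x = y.
Proof. by move=> m_gt1; rewrite !modn_small ?ltn_Zp // => /val_inj. Qed.

Lemma card_sdZU (m n : nat) (mn : Zdvd m n) : (1 < m)%N -> (1 < n)%N ->
  #|[set: sdZU mn]| = (m * totient n)%N.
Proof.
move=> m_gt1 n_gt1; rewrite -card_units_Zp ?(ltnW n_gt1) // !cardsT.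
transitivity #|{: 'Z_m * {unit 'Z_n}}|; first by [].
by rewrite card_prod card_ord Zp_cast.
Qed.

(** For e = 3, v lives modulo 1 and the odd t modulo 2, so both are constant and only u and s
    remain. *)
Lemma mulAut_Z8_isog : [set: mulAut 'Z_8] \isog [set: 'Z_2 * 'Z_2].
Proof.
have [||||F isoF _] := @psi2_misom 3 isT _ (fun x : 'Z_2 * 'Z_2 => x.1 : nat)
    (fun x => x.2 : nat) (fun=> 0%N) (fun=> 1%N).
- by [].
- move=> i j k l l_odd; exists (i%:R, j%:R).
  split; rewrite ?odd_Z2_nat ?modn1 //.
  by rewrite !modn2 l_odd.
- by move=> [x1 x2] [y1 y2] [/= /odd_Z2_inj-> /odd_Z2_inj->].
- by move=> x y; split; rewrite //= ?oddD ?odd_Z2D.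
exact: misom_isog isoF.
Qed.

(** For e = 4, v lives modulo 2, where the odd t acts trivially. An odd t modulo 4 is coded as 2x +
    1 with x modulo 2, which turns multiplication of t into addition of x. *)
Lemma mulAut_Z16_isog :
  [set: mulAut 'Z_16] \isog [set: 'Z_2 * 'Z_2 * 'Z_2 * 'Z_2].
Proof.
have odd_mod4 (a b : nat) : (a.*2.+1 == b.*2.+1 %[mod 4]) = (odd a == odd b).
  rewrite -!(addn1 _.*2) eqn_modDr -!muln2 -!(@muln_modl 2 _ 2) !modn2.
  by do 2!case: odd.
have [||||F isoF _] := @psi2_misom 4 isT _
    (fun x : 'Z_2 * 'Z_2 * 'Z_2 * 'Z_2 => x.1.1.1 : nat)
    (fun x => x.1.1.2 : nat) (fun x => x.1.2 : nat)
    (fun x => (x.2 : nat).*2.+1).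
- by move=> x /=; rewrite odd_double.
- move=> i j k l l_odd; exists (i%:R, j%:R, k%:R, (l./2)%:R).
  split; rewrite ?odd_Z2_nat //=; first by rewrite mod_Zp_nat.
  rewrite -[l in LHS]odd_double_half l_odd add1n.
  by apply/eqP; rewrite odd_mod4 odd_Z2_nat.
- move=> [[[x1 x2] x3] x4] [[[y1 y2] y3] y4] [/= /odd_Z2_inj-> /odd_Z2_inj->].
  move=> /mod_Zp_inj-> // /eqP.
  by rewrite odd_mod4 => /eqP/odd_Z2_inj->.
- move=> x y; split; rewrite //= ?oddD ?odd_Z2D //.
    rewrite -[(2 ^ _)%N]/2%N -[(Zp_trunc 2).+2]/2%N modn_mod !modn2 !oddD oddM.
    by rewrite /= odd_double andbT.
  have -> (a b : nat) : (a.*2.+1 * b.*2.+1 = (a + b + (a * b).*2).*2.+1)%N.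
    by rewrite -!muln2; ring.
  by apply/eqP; rewrite odd_mod4 odd_mod // !oddD odd_double addbF.
exact: misom_isog isoF.
Qed.

Lemma exprz_N1_5 (e : nat) (u v : int) : (4 <= e)%N ->
  (-1) ^ u * 5%:R ^ v
    = (-1) ^+ (u%:~R : 'Z_2) * 5%:R ^+ (v%:~R : 'Z_(2 ^ (e - 3)))
    :> 'Z_(2 ^ (e - 1)).
Proof.
move=> e_ge4; have e1_ge2 : (2 <= e - 1)%N.
  by rewrite ltn_subRL (leq_trans _ e_ge4).
rewrite -(@exprz_Zp _ (-1) 2) ?sqrrN ?expr1n //.
rewrite -(@exprz_Zp _ 5%:R (2 ^ (e - 3))) //.
  by rewrite pexp_gt1 // subn_gt0.
rewrite -val_five // -FinRing.val_unitX (_ : e - 3 = e - 1 - 2)%N.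
  by rewrite five_pow2.
by rewrite -subnDA.
Qed.

Lemma mulAut_two_misom (e : nat) : (4 <= e)%N ->
  exists2 F : mulAut 'Z_(2 ^ e) -> 'Z_2 * 'Z_2 * sdZU (Zdvd_two e),
    misom [set: mulAut 'Z_(2 ^ e)] [set: 'Z_2 * 'Z_2 * sdZU (Zdvd_two e)] F
  & forall (r : int) (s t : nat) (u v : int),
      coprimez r 2 ->
      T2 e (s, 0%N, t) ->
      (r%:~R : 'Z_(2 ^ (e - 1))) = (-1) ^ u * 5%:R ^ v ->
      exists chi : {perm {unit 'Z_(2 ^ e)}},
        unique (is_chi2 e (s, 0%N, t)) chi /\
        exists f : mulAut 'Z_(2 ^ e),
          unique (is_psi 2 e r chi) f /\
          F f = (u%:~R, (s %/ 2 ^ (e - 3))%:R, (v%:~R, unitZ (2 ^ (e - 2)) t)).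
Proof.
move=> e_ge4; have e_ge3 : (3 <= e)%N := ltnW e_ge4.
have e_ge2 : (2 <= e)%N := ltnW e_ge3; have e_gt0 : (0 < e)%N := ltnW e_ge2.
have m_gt1 : (1 < 2 ^ (e - 3))%N by rewrite pexp_gt1 // subn_gt0.
have n_gt1 : (1 < 2 ^ (e - 2))%N by rewrite pexp_gt1 // subn_gt0.
have odd_co t : odd t = coprime (2 ^ (e - 2)) t.
  by rewrite coprime_pexpl ?subn_gt0 // coprime2n.
have [||||F isoF FP] := @psi2_misom e e_ge3 _
    (fun x : 'Z_2 * 'Z_2 * sdZU (Zdvd_two e) => x.1.1 : nat)
    (fun x => x.1.2 : nat) (fun x => x.2.1 : nat)
    (fun x => (val x.2.2 : 'Z_(2 ^ (e - 2))) : nat).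
- by move=> x /=; rewrite odd_co coprime_unit_Zp.
- move=> i j k l l_odd; exists (i%:R, j%:R, (k%:R, unitZ (2 ^ (e - 2)) l)).
  split; rewrite ?odd_Z2_nat //=; first by rewrite mod_Zp_nat.
  rewrite val_unitZ //; first by rewrite mod_Zp_nat.
  by rewrite coprimezE /= coprime_sym -odd_co.
- move=> [[x1 x2] [x3 x4]] [[y1 y2] [y3 y4]] [/= /odd_Z2_inj-> /odd_Z2_inj->].
  by move=> /mod_Zp_inj-> // /mod_Zp_inj/val_inj->.
- move=> x y; have -> : (x * y)%g = ((x.1 * y.1)%g, (x.2 * y.2)%g) by [].
  rewrite sdZU_nat; split; rewrite /= ?oddD ?odd_Z2D //.
    by rewrite mod_Zp_nat.
  by rewrite -(mod_Zp_nat (_ * _)%N n_gt1) -Zp_natM.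
exists F => // r s t u v cor /and4P[s_in _ _ cot] rE.
have t_odd : odd t by rewrite -coprimen2.
(* Membership in [T2] makes s either 0 or 2^(e-3), so the division is exact and 5^s is a power of
   z. *)
have sE : s = (2 ^ (e - 3) * (s %/ 2 ^ (e - 3)))%N.
  rewrite mulnC; move: s_in; rewrite !inE => /orP[/eqP->|/eqP->].
    by rewrite div0n.
  by rewrite divnn expn_gt0 mul1n.
have [|chi [chiE chiU]] :=
  @is_chi2_unique e e_ge2 e_ge3 (s %/ 2 ^ (e - 3)) t t_odd s.
  by rewrite {1}sE expgM.
exists chi; split=> //.
have Ur : (r%:~R : 'Z_(2 ^ e)) \is a GRing.unit by apply: intr_unit_pexp.
have [f fE] := psi_two_exists e_ge2 e_ge3 (s %/ 2 ^ (e - 3)) t_odd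
  (FinRing.unit _ Ur).
have f_psi : is_psi 2 e r chi f by move=> k b _; rewrite fE chiE intrM.
exists f; split; first exact: unique_is_psi.
apply: FP; split.
- have := f_psi 1%N 1%g e_gt0; rewrite !mulr1 => ->.
  rewrite chiE (morphM1 (chi2M e_ge2 e_ge3 _ _)) mulr1 expr1 intrM
    val_neg1_five //; apply/eqP; rewrite mulp_eq //.
  by rewrite rE (exprz_N1_5 _ _ e_ge4) rmorphM !rmorphXn.
- have := f_psi 0%N (unitZ (2 ^ e) (-1)) isT.
  rewrite !mul1r chiE chi2_neg1 // => ->.
  by rewrite zetaX_mod // [in RHS]zetaX_mod // odd_Z2_nat.
- have := f_psi 0%N (unitZ (2 ^ e) 5) isT.
  rewrite !mul1r chiE chi2_five // => ->.
  congr val; apply/eqP; rewrite eq_expg_mod_order five_order //.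
  by rewrite val_unitZ //= ?mod_Zp_nat // coprimezE /= coprime_sym -odd_co.
Qed.

Theorem corollary3p6 :
  (forall p : nat, prime p -> odd p ->
     ([set: mulAut 'Z_p] \isog [set: {unit 'Z_(p.-1)}])%g
     /\ #|[set: mulAut 'Z_p]| = totient p.-1)
  /\
  (forall p e : nat, prime p -> odd p -> (2 <= e)%N ->
     [/\ ([set: mulAut 'Z_(p ^ e)] \isog [set: sdZU (Zdvd_odd p e)])%g,
         forall a : {unit 'Z_(p ^ (e - 1))},
           generator [set: {unit 'Z_(p ^ (e - 1))}] a ->
           exists2 F : mulAut 'Z_(p ^ e) -> sdZU (Zdvd_odd p e),
             misom [set: mulAut 'Z_(p ^ e)] [set: sdZU (Zdvd_odd p e)] F
           & forall (r : int) (t : nat) (s : int),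
               coprimez r p ->
               (t < p ^ (e - 1) * p.-1)%N ->
               coprime t (p ^ (e - 1) * p.-1) ->
               (r%:~R : 'Z_(p ^ (e - 1))) = val a ^ s ->
               exists f : mulAut 'Z_(p ^ e),
                 unique (is_psi p e r (chi_odd p e t)) f /\
                 F f = (s%:~R, unitZ (p ^ (e - 1) * p.-1) t)
       & #|[set: mulAut 'Z_(p ^ e)]|
           = ((p ^ (e - 2) * p.-1) ^ 2 * totient p.-1)%N])
  /\
  ([set: mulAut 'Z_8] \isog [set: 'Z_2 * 'Z_2])%g
  /\
  (forall e : nat, (4 <= e)%N ->
     [/\ ([set: mulAut 'Z_(2 ^ e)]
            \isog [set: 'Z_2 * 'Z_2 * sdZU (Zdvd_two e)])%g,
         exists2 F : mulAut 'Z_(2 ^ e) -> 'Z_2 * 'Z_2 * sdZU (Zdvd_two e),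
           misom [set: mulAut 'Z_(2 ^ e)]
                 [set: 'Z_2 * 'Z_2 * sdZU (Zdvd_two e)] F
         & forall (r : int) (s t : nat) (u v : int),
             coprimez r 2 ->
             T2 e (s, 0%N, t) ->
             (r%:~R : 'Z_(2 ^ (e - 1))) = (-1) ^ u * 5%:R ^ v ->
             exists chi : {perm {unit 'Z_(2 ^ e)}},
               unique (is_chi2 e (s, 0%N, t)) chi /\
               exists f : mulAut 'Z_(2 ^ e),
                 unique (is_psi 2 e r chi) f /\
                 F f = (u%:~R, (s %/ 2 ^ (e - 3))%:R,
                        (v%:~R, unitZ (2 ^ (e - 2)) t))
       & #|[set: mulAut 'Z_(2 ^ e)]| = (2 ^ (2 * (e - 2)))%N])
  /\
  ([set: mulAut 'Z_16] \isog [set: 'Z_2 * 'Z_2 * 'Z_2 * 'Z_2])%g.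
Proof.
split=> [p p_pr p_odd|].
  split; first exact: mulAut_Zp_isog.
  rewrite (card_isog (mulAut_Zp_isog p_pr p_odd)).
  by apply: card_units_Zp; rewrite -subn1 subn_gt0 prime_gt1.
split=> [p e p_pr p_odd e_ge2|].
  have e1_gt0 : (0 < e - 1)%N by rewrite subn_gt0.
  have isoS : [set: mulAut 'Z_(p ^ e)] \isog [set: sdZU (Zdvd_odd p e)].
    have /cyclicP[a Ua] := unit_pexp_cyclic p_pr p_odd e1_gt0.
    have [|F isoF _] := @mulAut_odd_misom p e p_pr p_odd e_ge2 a.
      by rewrite /generator Ua.
    exact: misom_isog isoF.
  split=> //; first exact: mulAut_odd_misom.
  rewrite (card_isog isoS) card_sdZU; first last.
  - exact: (card_unit_odd_gt1 p_pr p_odd erefl).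
  - by apply: (@card_unit_odd_gt1 p (e - 1)) => //; rewrite -subnDA.
  (* The totient of p^(e-1)(p-1) is p^(e-2)(p-1) times that of p - 1; the first factor equals the
     order of the cyclic part, whence the square. *)
  rewrite totient_coprime ?coprimeXl ?coprimenP ?prime_gt0 //.
  rewrite totient_pfactor // (_ : (e - 1).-1 = e - 2)%N; last first.
    by rewrite -subn1 -subnDA.
  by rewrite mulnA [(p.-1 * _)%N]mulnC.
split; first exact: mulAut_Z8_isog.
split=> [e e_ge4|]; last exact: mulAut_Z16_isog.
have [F isoF FP] := mulAut_two_misom e_ge4.
have e_ge3 : (3 <= e)%N := ltnW e_ge4.
split; [exact: misom_isog isoF | by exists F |].
rewrite (card_isog (misom_isog isoF)) cardsT 2!card_prod !card_ord.
rewrite -[X in (_ * X)%N]cardsT card_sdZU ?pexp_gt1 ?subn_gt0 //.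
rewrite totient_pfactor ?subn_gt0 //.
have -> : (e - 2 = (e - 3).+1)%N by rewrite -subSn // subSS.
by rewrite mul1n (mulnS 2 (e - 3)) expnD mul2n -addnn expnD.
Qed.
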